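(* There exist positive constants $c_2$ and $x_2$ such that for every $x>x_2$, $$\mathcal N_B(x) \gg e^{e^{c_2(\ln\ln\ln x)^2}}.$$
   Context: A Nov\'ak number is a positive integer $N$ such that $N$ divides $2^N+1$. For real $x$, $\mathcal N_B(x)$ denotes the number of Nov\'ak numbers $N\le x$. *)

(* Defs.v *)
From mathcomp Require Import all_boot all_order all_algebra.
From mathcomp Require Import all_classical all_reals all_analysis.
Set Implicit Arguments.
Unset Strict Implicit.
Unset Printing Implicit Defensive.
Import Order.TTheory GRing.Theory Num.Theory.
Local Open Scope ring_scope.

Definition novak (N : nat) : bool := ((0 < N) && (N %| 2 ^ N + 1))%N.

(* The index type 'I_(truncn x).+1 only makes the set visibly finite: every
   natural number N with N%:R <= x lies in it. *)
Definition novak_count (R : realType) (x : R) : nat :=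
  #|[pred N : 'I_(Num.truncn x).+1 | novak N && ((N : nat)%:R <= x)]|.

Lemma novak_count_range (R : realType) (x : R) (N : nat) :
  N%:R <= x -> (N < (Num.truncn x).+1)%N.
Proof.
by move=> Nx; rewrite ltnS truncn_ge_nat // (le_trans (ler0n R N) Nx).
Qed.

(* Main.v *)
Require Import Defs.
From mathcomp Require Import all_boot all_order all_algebra finfield.
From mathcomp Require Import all_classical all_reals all_analysis unstable.
From mathcomp Require Import zify lra.
Import Order.TTheory GRing.Theory Num.Theory.

(** For odd [n], [2 ^ n + 1] is the absolute value of [(-2) ^ n - 1], so a prime
    divides it exactly when the order of [-2] modulo that prime divides [n]. If [N]
    is a Novák number and [m] divides [2 ^ N + 1], then [N * m] is a Novák number;
    hence there are at least [2 ^ w] Novák numbers up to [N * (2 ^ N + 1)], where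
    [w] is the number of prime factors of [2 ^ N + 1]. By lifting the exponent,
    every odd [d > 16] whose prime factors have reciprocals of sum at most 1/2 is
    the order of [-2] modulo some prime. Let [M] be the product of 3 and of primes
    [p j], [j < k], modulo which [-2] has order [3 ^ (j + 3)]; since
    [p j > 3 ^ (j + 3)], the reciprocals of the factors of [M] have sum at most
    1/2. With [A = 3 ^ (k + 3)], the number [N = A * M ^ A] is a Novák number, it is
    at most [2 ^ A ^ 3], and its divisors [A * m], for [m] dividing [M ^ A], are the
    orders of [-2] modulo at least [A ^ (k + 1)] distinct primes dividing
    [2 ^ N + 1]. *)

Set Implicit Arguments.
Unset Strict Implicit.
Unset Printing Implicit Defensive.

Local Open Scope ring_scope.

(** * Lifting the exponent *)

Lemma dvdz_sub_eq (d m n : int) : (d %| m - n)%Z -> (d %| m)%Z = (d %| n)%Z.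
Proof. by move=> dmn; rewrite -[m](subrK n) rpredDl. Qed.

Lemma dvdz_exp_sub1 (x : int) (m n : nat) :
  (m %| n)%N -> (x ^+ m - 1 %| x ^+ n - 1)%Z.
Proof.
by case/dvdnP=> k ->; rewrite mulnC exprM [X in (_ %| X)%Z]subrX1 dvdz_mulr.
Qed.

Section GeometricSum.
Variable x : int.

Lemma dvdz_geometric_sumB (m : int) (n : nat) :
  (m %| x - 1)%Z -> (m %| \sum_(i < n) x ^+ i - n%:Z)%Z.
Proof.
move=> mx; have -> : n%:Z = \sum_(i < n) 1 by rewrite sumr_const card_ord natz.
by rewrite -sumrB rpred_sum // => i _; rewrite subrX1 dvdz_mulr.
Qed.

Lemma dvdz_geometric_sum (m n : nat) :
  (m %| x - 1)%Z -> (m %| \sum_(i < n) x ^+ i)%Z = (m %| n)%N.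
Proof. by move=> /(dvdz_geometric_sumB n)/dvdz_sub_eq->. Qed.

Lemma dvdz_mul_exp_sub1 (m : nat) :
  (m %| x - 1)%Z -> (m%:Z * (x - 1) %| x ^+ m - 1)%Z.
Proof.
by move=> mx; rewrite subrX1 mulrC dvdz_mul // dvdz_geometric_sum.
Qed.

(* Modulo [q ^ 2] the sum is [q + (x - 1) * 'C(q, 2)]. *)
Lemma dvdz_sqr_geometric_sumB (q : nat) : prime q -> odd q ->
  (q %| x - 1)%Z -> ((q ^ 2)%N %| \sum_(i < q) x ^+ i - q%:Z)%Z.
Proof.
move=> q_prime q_odd qx.
have -> : \sum_(i < q) x ^+ i - q%:Z
    = (x - 1) * \sum_(i < q) \sum_(j < i) x ^+ j.
  rewrite mulr_sumr -[q%:Z]natz -[q in q%:R](card_ord q) -sumr_const -sumrB.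
  by apply: eq_bigr => i _; rewrite subrX1.
rewrite -mulnn PoszM dvdz_mul //.
have q_bin2 : (q%:Z %| \sum_(i < q) i%:Z)%Z.
  rewrite -(big_morph Posz PoszD (erefl _)) -(big_mkord xpredT id) bin2_sum.
  by apply: prime_dvd_bin => //; have := prime_gt1 q_prime; lia.
rewrite -(rpredBr _ q_bin2) -sumrB rpred_sum // => i _.
exact: dvdz_geometric_sumB.
Qed.

Lemma logn_geometric_sum_prime (q r : nat) : prime q -> prime r -> odd r ->
  (q %| x - 1)%Z -> logn q (absz (\sum_(i < r) x ^+ i)) = (q == r).
Proof.
move=> q_prime r_prime r_odd qx; have qS := dvdz_geometric_sum r qx.
have [eqr|neqr] := eqVneq q r; last first.
  by rewrite lognE [(q %| _)%N]qS dvdn_prime2 // (negbTE neqr) !andbF.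
subst r; set S := \sum_(i < q) _; have q1 := prime_gt1 q_prime.
have sqr_ndvd : ~~ (q ^ 2 %| absz S)%N.
  rewrite [X in ~~ X](dvdz_sub_eq (dvdz_sqr_geometric_sumB q_prime r_odd qx)).
  by have := dvdn_Pexp2l 2 1 q1; rewrite expn1 => q2; rewrite [X in ~~ X]q2.
have S0 : (0 < absz S)%N by case: posnP sqr_ndvd => // ->; rewrite dvdn0.
apply/eqP; rewrite eqn_leq -ltnS ltnNge -!pfactor_dvdn // sqr_ndvd expn1.
by rewrite [(q %| _)%N]qS dvdnn.
Qed.

End GeometricSum.

Lemma logn_exp_sub1 (x : int) (q n : nat) : prime q -> odd n ->
    (q %| x - 1)%Z -> x ^+ n != 1 ->
  logn q (absz (x ^+ n - 1)) = (logn q n + logn q (absz (x - 1)%R))%N.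
Proof.
move=> q_prime; elim/ltn_ind: n x => n IH x n_odd qx xn1.
have [n_le1|n_gt1] := leqP n 1.
  by rewrite (_ : n = 1%N) ?expr1 ?logn1 //; lia.
have := pdiv_prime n_gt1; have := pdiv_dvd n.
move: (pdiv n) => r /dvdnP[m nE] r_prime; have r_gt1 := prime_gt1 r_prime.
move: n_odd xn1; rewrite nE oddM mulnC exprM => /andP[m_odd r_odd] xrm1.
have xr1 : x ^+ r != 1 by apply: contraNneq xrm1 => ->; rewrite expr1n.
have m0 := odd_gt0 m_odd.
rewrite IH //; [|by nia|by rewrite subrX1 dvdz_mulr].
move: xr1; rewrite -subr_eq0 subrX1 mulf_eq0 => /norP[x1 S0].
rewrite abszM !lognM ?absz_gt0 // ?prime_gt0 //.
by rewrite logn_geometric_sum_prime // (logn_prime q r_prime) addnC -addnA addnC.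
Qed.

(** * Primitive prime divisors *)

Local Open Scope nat_scope.

Lemma prod_primes_dvdn (s : seq nat) (n : nat) : uniq s -> all prime s ->
  (forall p, p \in s -> p %| n) -> \prod_(p <- s) p %| n.
Proof.
move=> s_uniq /allP s_prime s_dvd; apply/Gauss_dvd_prod => [|p /s_dvd //].
rewrite filter_predT map_id; apply/(pairwiseP 0) => i j si sj ij.
rewrite prime_coprime ?s_prime ?mem_nth // dvdn_prime2 ?s_prime ?mem_nth //.
by rewrite nth_uniq // ltn_eqF.
Qed.

Lemma sqr_lt_exp2_uphalf (n : nat) : 16 < n -> n ^ 2 < 2 ^ uphalf n.
Proof.
move=> n_gt16; have : 9 <= uphalf n by lia.
have : n <= 2 * uphalf n by lia.
move: (uphalf n) => m nm m_ge9; apply: (@leq_ltn_trans ((2 * m) ^ 2)).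
  by rewrite leq_sqr.
elim: m m_ge9 {nm} => // m IH; rewrite leq_eqVlt => /predU1P[<- //|m_ge9].
by have := IH m_ge9; rewrite [2 ^ m.+1]expnS -!mulnn; nia.
Qed.

Definition primitive_prime (b : int) (d q : nat) : bool :=
  prime q && d.-primitive_root (b%:~R : 'F_q)%R.

Section PrimitivePrime.
Variable b : int.

Lemma dvdn_exp_sub1_Fp (q n : nat) : prime q ->
  (q %| absz (b ^+ n - 1)%R) = (b%:~R ^+ n == 1 :> 'F_q)%R.
Proof.
move=> q_prime; rewrite [LHS](dvdz_pcharf (pchar_Fp q_prime)) rmorphB rmorphXn.
by rewrite rmorph1 subr_eq0.
Qed.

Lemma primitive_prime_dvdn (d q n : nat) : primitive_prime b d q ->
  (q %| absz (b ^+ n - 1)%R) = (d %| n).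
Proof.
by case/andP=> q_prime z_prim; rewrite dvdn_exp_sub1_Fp // (prim_order_dvd z_prim).
Qed.

Lemma primitive_prime_inj (d d' q : nat) :
  primitive_prime b d q -> primitive_prime b d' q -> d = d'.
Proof.
suff dvd (m n : nat) :
    primitive_prime b m q -> primitive_prime b n q -> m %| n.
  by move=> dq d'q; apply/eqP; rewrite eqn_dvd !dvd.
by move=> mq nq; rewrite -(primitive_prime_dvdn _ mq) (primitive_prime_dvdn _ nq).
Qed.

Lemma primitive_prime_gt (d q : nat) : primitive_prime b d q -> d < q.
Proof.
case/andP=> q_prime; move: (b%:~R)%R => z z_prim; have q1 := prime_gt1 q_prime.
have z0 : (z != 0)%R.
  apply/eqP => z0; have /esym/eqP := prim_expr_order z_prim.
  by rewrite z0 expr0n eqn0Ngt (prim_order_gt0 z_prim) oner_eq0.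
have zq := expf_card z; rewrite card_Fp // in zq.
have fermat : (z ^+ q.-1 = 1)%R.
  by apply: (mulfI z0); rewrite -exprS (prednK (ltnW q1)) mulr1; exact: zq.
have : d %| q.-1 by rewrite (prim_order_dvd z_prim) fermat.
by move/dvdn_leq; lia.
Qed.

Lemma primitive_prime_or_dvdn_divn (d q : nat) : prime q -> 0 < d ->
    q %| absz (b ^+ d - 1)%R ->
  primitive_prime b d q \/
  exists2 r, r \in primes d & q %| absz (b ^+ (d %/ r) - 1)%R.
Proof.
move=> q_prime d0; rewrite dvdn_exp_sub1_Fp // => /eqP.
case/(prim_order_exists d0) => m z_prim md.
have [<-|m_neq_d] := eqVneq m d.
  by left; rewrite /primitive_prime q_prime.
right; have dm_gt1 : 1 < d %/ m.
  by rewrite ltn_divRL // mul1n ltn_neqAle m_neq_d dvdn_leq.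
have r_dm := pdiv_dvd (d %/ m); have r_d := dvdn_trans r_dm (dvdn_div md).
exists (pdiv (d %/ m)); first by rewrite mem_primes pdiv_prime // d0.
rewrite dvdn_exp_sub1_Fp // -(prim_order_dvd z_prim) dvdn_divRL // mulnC.
by rewrite -dvdn_divRL.
Qed.

(* If every prime factor of [b ^ d - 1] divided some [b ^ (d / r) - 1], then
   by lifting the exponent [b ^ d - 1] would divide the product. *)
Lemma primitive_prime_exists (d : nat) : odd d ->
    \prod_(r <- primes d) (r * absz (b ^+ (d %/ r) - 1)%R)
      < absz (b ^+ d - 1)%R ->
  exists q, primitive_prime b d q.
Proof.
move=> d_odd; rewrite ltnNge => /negP prod_lt; apply: contrapT => no_prim.
apply: prod_lt.
have [-> //|bd0] := posnP (absz (b ^+ d - 1)%R).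
have factor_gt0 r : r \in primes d -> 0 < r * absz (b ^+ (d %/ r) - 1)%R.
  rewrite mem_primes => /and3P[r_prime _ rd]; rewrite muln_gt0 prime_gt0 //=.
  by apply: dvdn_gt0 bd0 _; apply/dvdz_exp_sub1/dvdn_div.
have prod_gt0 : 0 < \prod_(r <- primes d) (r * absz (b ^+ (d %/ r) - 1)%R).
  by rewrite big_seq; apply: prodn_cond_gt0 => r /factor_gt0.
apply: dvdn_leq => //; apply/dvdn_partP => // q; rewrite mem_primes.
case/and3P=> q_prime _ qd.
have [qd_prim|[r rd qr]] := primitive_prime_or_dvdn_divn q_prime (odd_gt0 d_odd) qd.
  by case: no_prim; exists q.
have factor_dvdn : r * absz (b ^+ (d %/ r) - 1)%R
    %| \prod_(s <- primes d) (s * absz (b ^+ (d %/ s) - 1)%R).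
  by rewrite (big_rem r) //= dvdn_mulr.
have := factor_gt0 r rd; rewrite muln_gt0 => /andP[r0 br0].
move: rd; rewrite mem_primes => /and3P[r_prime _ rd].
rewrite p_part pfactor_dvdn //.
apply: leq_trans (dvdn_leq_log q prod_gt0 factor_dvdn).
rewrite lognM // -{1}(divnK rd) exprM logn_exp_sub1 ?(dvdn_odd rd) //.
by rewrite -exprM divnK // -subr_eq0 -absz_gt0.
Qed.

Lemma leq_size_primes_exp_sub1 (n : nat) (s : seq nat) :
    (b ^+ n != 1)%R -> uniq s ->
    (forall d, d \in s -> d %| n /\ exists q, primitive_prime b d q) ->
  size s <= size (primes (absz (b ^+ n - 1)%R)).
Proof.
rewrite -subr_eq0 -absz_gt0 => bn_gt0 s_uniq s_prim; set P := primes _.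
pose q d := nth 0 P (find (primitive_prime b d) P).
have P_prim d : d \in s -> has (primitive_prime b d) P.
  case/s_prim => dn [r r_prim]; apply/hasP; exists r => //.
  have [r_prime _] := andP r_prim.
  by rewrite mem_primes r_prime bn_gt0 (primitive_prime_dvdn _ r_prim).
rewrite -(size_map q); apply: uniq_leq_size.
  rewrite map_inj_in_uniq // => d d' ds d's qdd'.
  apply: primitive_prime_inj (nth_find 0 (P_prim d ds)) _.
  by rewrite -/(q d) qdd'; exact: nth_find (P_prim d' d's).
by move=> _ /mapP[d /P_prim dP ->]; rewrite mem_nth // -has_find.
Qed.

Lemma primitive_prime_exists_recip_sum (d : nat) :
    1 < absz b -> odd d -> 16 < d ->
    2 * (\sum_(r <- primes d) d %/ r) <= d ->
  exists q, primitive_prime b d q.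
Proof.
move=> b_gt1 d_odd d_gt16 sum_le; apply: primitive_prime_exists => //.
have radical_le : \prod_(r <- primes d) r <= d.
  apply: dvdn_leq; first exact: odd_gt0.
  apply: prod_primes_dvdn; rewrite ?primes_uniq ?all_prime_primes //.
  by move=> r; rewrite mem_primes => /and3P[].
have factor_le r : r \in primes d ->
    r * absz (b ^+ (d %/ r) - 1)%R <= r ^ 2 * absz b ^ (d %/ r).
  rewrite mem_primes => /andP[/prime_gt1 r_gt1 _].
  have := abszX (d %/ r) b; have := expn_gt0 (absz b) (d %/ r).
  by move: (b ^+ (d %/ r))%R => y; nia.
have prod_le : \prod_(r <- primes d) (r * absz (b ^+ (d %/ r) - 1)%R)
    <= d ^ 2 * absz b ^ d./2.
  rewrite big_seq; apply: leq_trans (leq_prod factor_le) _.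
  rewrite -big_seq big_split /= -expn_sum -expn_prod leq_mul ?leq_sqr //.
  by rewrite leq_exp2l //; lia.
apply: leq_ltn_trans prod_le _.
have half_ge2 : 2 <= absz b ^ d./2.
  by rewrite (leq_trans b_gt1) // -[leqLHS]expn1 leq_exp2l //; lia.
have uphalf_gt : d ^ 2 < absz b ^ uphalf d.
  by rewrite (leq_trans (sqr_lt_exp2_uphalf d_gt16)) // leq_exp2r //; lia.
have expE : absz b ^ d = absz b ^ uphalf d * absz b ^ d./2.
  by rewrite -expnD; congr (_ ^ _); lia.
have exp_gt : d ^ 2 * absz b ^ d./2 + 1 < absz b ^ d by rewrite expE; nia.
by have := abszX d b; move: (b ^+ d)%R => y; lia.
Qed.

End PrimitivePrime.

(** * Novák numbers *)

Lemma absz_expN2_sub1 (n : nat) :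
  odd n -> absz ((-2 : int) ^+ n - 1)%R = 2 ^ n + 1.
Proof.
move=> n_odd; rewrite exprNn -signr_odd n_odd mulN1r -opprD abszN.
by rewrite -natrX natr1 natz addn1.
Qed.

Lemma dvdn_exp2_add1 (m n : nat) : odd n -> m %| n -> 2 ^ m + 1 %| 2 ^ n + 1.
Proof.
move=> n_odd mn; rewrite -!absz_expN2_sub1 ?(dvdn_odd mn) //.
exact: dvdz_exp_sub1.
Qed.

Lemma odd_exp2_add1 (n : nat) : 0 < n -> odd (2 ^ n + 1).
Proof. by case: n => // n _; rewrite oddD oddX. Qed.

Lemma novak_odd (N : nat) : novak N -> odd N.
Proof. by case/andP=> N0 NN; exact: dvdn_odd NN (odd_exp2_add1 N0). Qed.

Lemma novak_mul (N m : nat) : novak N -> m %| 2 ^ N + 1 -> novak (N * m).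
Proof.
move=> N_novak mN; have N_odd := novak_odd N_novak; case/andP: N_novak => N0 NN.
have m_odd := dvdn_odd mN (odd_exp2_add1 N0).
rewrite /novak muln_gt0 N0 odd_gt0 //=.
rewrite -absz_expN2_sub1 // in mN NN; rewrite -absz_expN2_sub1 ?oddM ?N_odd //.
rewrite exprM; apply: dvdn_trans (dvdz_mul_exp_sub1 mN).
by rewrite abszM mulnC dvdn_mul.
Qed.

Lemma novak_mulX (N m e : nat) :
  novak N -> m %| 2 ^ N + 1 -> novak (N * m ^ e).
Proof.
move=> N_novak mN; elim: e => [|e IH]; first by rewrite muln1.
rewrite expnSr mulnA novak_mul // (dvdn_trans mN) //.
by rewrite dvdn_exp2_add1 ?novak_odd // dvdn_mulr.
Qed.

Lemma novak_exp3 (e : nat) : novak (3 ^ e).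
Proof. by rewrite -[_ ^ _]mul1n novak_mulX. Qed.

Lemma size_leq_novak_count (R : realType) (x : R) (s : seq nat) : uniq s ->
  (forall N, N \in s -> novak N /\ (N%:R <= x)%R) -> size s <= novak_count x.
Proof.
move=> s_uniq s_novak; pose f N : 'I_(Num.truncn x).+1 := inord N.
have fK N : N \in s -> f N = N :> nat.
  by move=> /s_novak[_ Nx]; rewrite inordK // novak_count_range.
have f_uniq : uniq (map f s).
  by rewrite map_inj_in_uniq // => N N' Ns N's /(congr1 val) /=; rewrite !fK.
rewrite -(size_map f) -(card_uniqP f_uniq).
apply/subset_leq_card/fintype.subsetP => _ /mapP[N Ns ->].
by rewrite inE /= fK //; apply/andP/s_novak.
Qed.

Lemma size_divisors_leq_novak_count (R : realType) (x : R) (N : nat) :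
    novak N -> ((N * (2 ^ N + 1))%:R <= x)%R ->
  size (divisors (2 ^ N + 1)) <= novak_count x.
Proof.
move=> N_novak Nx; have [N0 _] := andP N_novak.
rewrite -(size_map (muln N)); apply: size_leq_novak_count.
  rewrite map_inj_uniq ?divisors_uniq // => m m' /eqP.
  by rewrite eqn_pmul2l // => /eqP.
move=> _ /mapP[m + ->]; rewrite -dvdn_divisors ?addn1 // -addn1 => mN.
split; first exact: novak_mul.
by apply: le_trans Nx; rewrite ler_nat leq_mul2l dvdn_leq ?orbT // addn1.
Qed.

(** * Novák numbers with many primitive divisors *)

Lemma size_divisors (n : nat) :
  size (divisors n) = \prod_(p <- primes n) (logn p n).+1.
Proof.
have size_add p e s :
    size (PrimeDecompAux.add_divisors (p, e) s) = e.+1 * size s.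
  rewrite /=; elim: e => [|e IH] /=; first by rewrite mul1n.
  by rewrite size_merge size_cat size_map IH [RHS]mulSn addnC.
have -> : \prod_(p <- primes n) (logn p n).+1
    = \prod_(f <- prime_decomp n) f.2.+1.
  by rewrite prime_decompE big_map.
rewrite /divisors; elim: (prime_decomp n) => [|[p e] s IH].
  by rewrite big_nil.
by rewrite big_cons /= -/(PrimeDecompAux.add_divisors (p, e) _) size_add IH.
Qed.

Lemma leq_size_divisorsX (n e : nat) :
  0 < n -> e.+1 ^ size (primes n) <= size (divisors (n ^ e)).
Proof.
move=> n0; case: e => [|e]; first by rewrite exp1n.
rewrite size_divisors primesX // big_seq -sum1_size big_seq expn_sum.
apply: leq_prod => p; rewrite mem_primes => /and3P[p_prime _ pn].
by rewrite expn1 ltnS lognX leq_pmulr // -pfactor_dvdn.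
Qed.

Lemma sum_divn_geometric (c n k : nat) :
  c * (\sum_(j < k) n %/ c.+1 ^ j.+1) + n %/ c.+1 ^ k <= n.
Proof.
elim: k => [|k]; first by rewrite big_ord0 muln0 divn1.
apply: leq_trans; rewrite big_ord_recr /= mulnDr -addnA leq_add2l addnC -mulSn.
by rewrite expnSr divnMA mulnC leq_trunc_div.
Qed.

(* [\sum_(r <- s) 1 / r <= 1 / 2], freed from denominators. *)
Definition recip_sum_le_half (s : seq nat) : Prop :=
  forall d, 2 * (\sum_(r <- s) d %/ r) <= d.

Lemma recip_sum_le_half_geometric (s : seq nat) :
  (forall i, i < size s -> 3 ^ i.+1 <= nth 0 s i) -> recip_sum_le_half s.
Proof.
move=> s_ge d; apply: leq_trans (sum_divn_geometric 2 d (size s)).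
apply: leq_trans (leq_addr _ _); rewrite leq_mul2l /= (big_nth 0) big_mkord.
by apply: leq_sum => i _; rewrite leq_div2l ?expn_gt0 ?s_ge.
Qed.

Lemma sub_recip_sum_le_half (s t : seq nat) : uniq s -> uniq t ->
  {subset s <= t} -> recip_sum_le_half t -> recip_sum_le_half s.
Proof.
move=> s_uniq t_uniq st t_half d; apply: leq_trans (t_half d).
by rewrite leq_mul2l; apply: uniq_sub_le_big => // *; apply: leq_addr.
Qed.

Section ManyPrimitiveDivisors.
Variables (A : nat) (t : seq nat).
Hypotheses (A_novak : novak A) (A_gt16 : 16 < A).
Hypothesis A_primes : {subset primes A <= t}.
Hypotheses (t_uniq : uniq t) (t_half : recip_sum_le_half t).
Hypothesis t_dvdn : forall q, q \in t -> prime q /\ q %| 2 ^ A + 1.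

Let M := \prod_(q <- t) q.

Lemma prod_dvdn_exp2_add1 : M %| 2 ^ A + 1.
Proof.
by apply: prod_primes_dvdn => // [|q /t_dvdn[]//]; apply/allP => q /t_dvdn[].
Qed.

Lemma prod_primes_gt0 : 0 < M.
Proof. by rewrite (dvdn_gt0 _ prod_dvdn_exp2_add1) ?addn1. Qed.

Lemma novak_mul_prodX (e : nat) : novak (A * M ^ e).
Proof. exact: novak_mulX prod_dvdn_exp2_add1. Qed.

Lemma primes_mul_dvdn_prodX (e m : nat) :
  m %| M ^ e -> {subset primes (A * m) <= t}.
Proof.
move=> mM r; rewrite mem_primes => /and3P[r_prime _]; rewrite Euclid_dvdM //.
case/orP=> [rA|rm].
  by rewrite A_primes // mem_primes r_prime rA; case/andP: A_novak => ->.
have := dvdn_trans rm mM; rewrite Euclid_dvdX // => /andP[+ _].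
rewrite Euclid_dvd_prod // big_has => /hasP[q qt].
by rewrite dvdn_prime2 //; [move/eqP-> | case: (t_dvdn qt)].
Qed.

Lemma primitive_prime_mul_dvdn_prodX (e m : nat) :
  m %| M ^ e -> exists q, primitive_prime (-2)%R (A * m) q.
Proof.
move=> mM; have m0 : 0 < m.
  by rewrite (dvdn_gt0 _ mM) // expn_gt0 prod_primes_gt0.
apply: primitive_prime_exists_recip_sum => //.
- exact: dvdn_odd (dvdn_mul (dvdnn A) mM) (novak_odd (novak_mul_prodX e)).
- by rewrite (leq_trans A_gt16) // leq_pmulr.
apply: sub_recip_sum_le_half t_half _; rewrite ?primes_uniq //.
exact: primes_mul_dvdn_prodX mM.
Qed.

Lemma leq_size_primes_novak (e : nat) :
  e.+1 ^ size t <= size (primes (2 ^ (A * M ^ e) + 1)).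
Proof.
have [A0 _] := andP A_novak; have M0 := prod_primes_gt0.
have N_odd := novak_odd (novak_mul_prodX e).
apply: (@leq_trans (size (divisors (M ^ e)))).
  apply: leq_trans (leq_size_divisorsX e M0).
  rewrite leq_pexp2l // uniq_leq_size // => q qt.
  rewrite mem_primes M0 /M (big_rem q) //= dvdn_mulr // andbT.
  by case: (t_dvdn qt).
rewrite -(size_map (muln A)) -absz_expN2_sub1 //.
apply: leq_size_primes_exp_sub1.
- by rewrite -subr_eq0 -absz_eq0 absz_expN2_sub1 // addn1.
- rewrite map_inj_uniq ?divisors_uniq // => m m' /eqP.
  by rewrite eqn_pmul2l // => /eqP.
move=> _ /mapP[m + ->]; rewrite -dvdn_divisors ?expn_gt0 ?M0 // => mM.
by split; [exact: dvdn_mul | exact: primitive_prime_mul_dvdn_prodX mM].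
Qed.

Lemma exp2_leq_novak_count (R : realType) (x : R) (e : nat) :
    ((A * M ^ e * (2 ^ (A * M ^ e) + 1))%:R <= x)%R ->
  2 ^ e.+1 ^ size t <= novak_count x.
Proof.
move=> /(size_divisors_leq_novak_count (novak_mul_prodX e)); apply: leq_trans.
set N := A * M ^ e; have N0 : 0 < 2 ^ N + 1 by rewrite addn1.
have := leq_size_divisorsX 1 N0; rewrite expn1; apply: leq_trans.
by rewrite leq_exp2l // leq_size_primes_novak.
Qed.

End ManyPrimitiveDivisors.

(** * A lower bound at towers of exponentials *)

Lemma primitive_prime_exp3 (j : nat) :
  exists q, primitive_prime (-2)%R (3 ^ (j + 3)) q.
Proof.
apply: primitive_prime_exists_recip_sum => //; rewrite ?oddX ?orbT //.
  by rewrite (@leq_trans (3 ^ 3)) // leq_exp2l // leq_addl.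
by rewrite addnS primesX // primes_prime // big_seq1 expnS mulKn // leq_mul.
Qed.

Lemma exists_sparse_primes (k : nat) : exists t,
  [/\ size t = k.+1, uniq t, recip_sum_le_half t, 3 \in t &
      forall q, q \in t -> prime q /\ q %| 2 ^ 3 ^ (k + 3) + 1].
Proof.
have [p p_prim] := choice primitive_prime_exp3.
have p_gt j : 3 ^ (j + 3) < p j := primitive_prime_gt (p_prim j).
have p_inj : injective p.
  move=> i j pij; have := p_prim j.
  rewrite -pij => /(primitive_prime_inj (p_prim i))/eqP.
  by rewrite eqn_exp2l // eqn_add2r => /eqP.
exists (3 :: map p (iota 0 k)); split; rewrite ?mem_head //.
- by rewrite /= size_map size_iota.
- rewrite /= map_inj_uniq ?iota_uniq // andbT; apply/mapP => -[j _ p3].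
  by have := p_gt j; rewrite -p3 addn3 !expnS; have := expn_gt0 3 j; lia.
- apply: recip_sum_le_half_geometric => -[|j] //=.
  rewrite size_map size_iota => jk; rewrite (nth_map 0) ?size_iota // nth_iota //.
  by rewrite ltnW // (leq_ltn_trans _ (p_gt j)) // leq_exp2l // addn3.
move=> q; rewrite inE => /predU1P[->|/mapP[j + ->]].
  by split=> //; apply: (@dvdn_exp2_add1 1); rewrite ?oddX ?orbT ?dvd1n.
rewrite mem_iota add0n => jk; split; first by case/andP: (p_prim j).
rewrite -absz_expN2_sub1 ?oddX ?orbT // (primitive_prime_dvdn _ (p_prim j)).
by rewrite dvdn_Pexp2l //; lia.
Qed.

Lemma leq_mul_exp2_add1 (n : nat) : n * (2 ^ n + 1) <= 2 ^ (3 * n).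
Proof.
case: n => // n; have -> : 3 * n.+1 = n.+1 + (n.+1 + n.+1) by lia.
rewrite expnD leq_mul ?(ltnW (ltn_expl _ _)) // expnD.
have exp2_ge2 : 2 <= 2 ^ n.+1 by rewrite expnS leq_pmulr ?expn_gt0.
by nia.
Qed.

Lemma leq_mul_expn_exp2_cube (a m : nat) :
  2 < a -> m <= 2 ^ a + 1 -> a * m ^ a <= 2 ^ a ^ 3.
Proof.
move=> a_gt2 m_le; have m_le_exp2 : m <= 2 ^ a.+1.
  by rewrite (leq_trans m_le) // expnS mul2n -addnn leq_add2l expn_gt0.
apply: (@leq_trans (2 ^ a * (2 ^ a.+1) ^ a)).
  by rewrite leq_mul ?(ltnW (ltn_expl _ _)) // leq_exp2r //; lia.
by rewrite -expnM -expnD leq_exp2l // !expnS expn0; nia.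
Qed.

Lemma novak_count_tower (R : realType) (x : R) (k : nat) : 3 <= k ->
  ((2 ^ 2 ^ 3 ^ (8 * k))%:R <= x)%R -> 2 ^ 3 ^ k ^ 2 <= novak_count x.
Proof.
move=> k_ge3 x_ge; set A := 3 ^ (k + 3).
have [t [size_t t_uniq t_half t3 t_dvdn]] := exists_sparse_primes k.
have A_gt16 : 16 < A by rewrite (@leq_trans (3 ^ 3)) // leq_exp2l // leq_addl.
have A_primes : {subset primes A <= t}.
  by move=> q; rewrite /A addnS primesX // primes_prime // inE => /eqP->.
set M := \prod_(q <- t) q; set N := A * M ^ A.
have N_le : N <= 2 ^ A ^ 3.
  apply: leq_mul_expn_exp2_cube; first exact: leq_trans A_gt16.
  by rewrite dvdn_leq ?addn1 // -addn1 prod_dvdn_exp2_add1.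
have Nx : ((N * (2 ^ N + 1))%:R <= x)%R.
  apply: le_trans x_ge; rewrite ler_nat.
  apply: leq_trans (leq_mul_exp2_add1 N) _; rewrite leq_exp2l //.
  apply: (@leq_trans (2 ^ (2 + A ^ 3))); first by rewrite expnD leq_mul.
  rewrite leq_exp2l //; apply: (@leq_trans (A ^ 4)).
    have A3 : A <= A ^ 3 by rewrite -[leqLHS]expn1 leq_pexp2l //; lia.
    by rewrite [A ^ 4]expnS; nia.
  by rewrite /A -expnM leq_exp2l //; lia.
have := exp2_leq_novak_count (novak_exp3 _) A_gt16 A_primes t_uniq t_half t_dvdn Nx.
rewrite size_t; apply: leq_trans; rewrite leq_exp2l //.
apply: (@leq_trans (A ^ k.+1)); last by rewrite leq_exp2r.
by rewrite /A -expnM leq_exp2l //; nia.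
Qed.

Local Open Scope ring_scope.

Section ExponentialTowers.
Variable R : realType.

Lemma natr_expn_le_expR (a m : nat) (y : R) :
  m%:R * a.-1%:R <= y -> (a ^ m)%:R <= expR y.
Proof.
move=> my; apply: (@le_trans _ _ (expR (m%:R * a.-1%:R))); last by rewrite ler_expR.
rewrite expRM_natl natrX lerXn2r ?nnegrE ?ler0n ?expR_ge0 //.
by apply: le_trans (expR_ge1Dx _); rewrite nat1r ler_nat leqSpred.
Qed.

Lemma expR_half_le_natr_expn (a m : nat) :
  (2 <= a)%N -> expR (m%:R / 2) <= (a ^ m)%:R :> R.
Proof.
move=> a_ge2; rewrite expRM_natl natrX lerXn2r ?nnegrE ?ler0n ?expR_ge0 //.
apply: (@le_trans _ _ 2); last by rewrite ler_nat.
rewrite -[2^-1]opprK expRN invf_ple ?posrE ?expR_gt0 //.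
by apply: le_trans (expR_ge1Dx _); lra.
Qed.

Lemma natr_tower_le_expR (m : nat) (y : R) :
  m%:R * 2 <= y -> (2 ^ 2 ^ 3 ^ m)%:R <= expR (expR (expR y)).
Proof. by move=> my; do 3!rewrite natr_expn_le_expR //= ?mulr1. Qed.

Lemma expR_expR_le_natr_tower (m : nat) (y : R) :
  y + 1 <= m%:R / 2 -> expR (expR y) <= (2 ^ 3 ^ m)%:R.
Proof.
move=> ym; apply: le_trans (expR_half_le_natr_expn _ (leqnn 2)).
rewrite ler_expR ler_pdivlMr //.
apply: le_trans (expR_half_le_natr_expn _ (leqnSn 2)).
have e_ge2 : 2 <= expR (1 : R) by apply: le_trans (expR_ge1Dx _).
by rewrite (le_trans (ler_wpM2l (expR_ge0 _) e_ge2)) // -expRD ler_expR.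
Qed.

Lemma expR_lt_ex (a x : R) : expR a < x -> exists2 y, a < y & x = expR y.
Proof.
move=> ax; have xE : expR (ln x) = x.
  by rewrite lnK // posrE (lt_trans (expR_gt0 a)).
by exists (ln x); rewrite // -ltr_expR xE.
Qed.

End ExponentialTowers.

Theorem theorem1 (R : realType) :
  exists c2 x2 : R, 0 < c2 /\ 0 < x2 /\
    exists K : R, 0 < K /\
      forall x : R, x2 < x ->
        K * expR (expR (c2 * (ln (ln (ln x))) ^+ 2)) <= (novak_count x)%:R.
Proof.
exists (1 / 2000), (expR (expR (expR 48))); split; first by lra.
split; first exact: expR_gt0.
exists 1; split=> // x.
case/expR_lt_ex=> _ /expR_lt_ex[_ /expR_lt_ex[L L_gt48 ->] ->] ->.
rewrite mul1r !expRK; set k := Num.truncn (L / 16).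
have /andP[kL Lk] : k%:R <= L / 16 < k.+1%:R by apply: truncn_itv; lra.
have k_ge3 : (3 <= k)%N by rewrite -ltnS -(ltr_nat R) (lt_trans _ Lk) //; lra.
have tower_le : (2 ^ 2 ^ 3 ^ (8 * k))%:R <= expR (expR (expR L)).
  by apply: natr_tower_le_expR; rewrite natrM; lra.
have := novak_count_tower k_ge3 tower_le; rewrite -(ler_nat R); apply: le_trans.
apply: expR_expR_le_natr_tower; rewrite natrX.
have kr_ge3 : 3 <= k%:R :> R by rewrite (ler_nat R 3).
have L_sqr_le : L ^+ 2 <= (16 * (k%:R + 1)) ^+ 2.
  by apply: lerXn2r; rewrite ?nnegrE; lra.
by nra.
Qed.
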